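(* Let $G$ be a triangle-free graph with $|E(G)|\ge 4$, $\operatorname{diam}(G)=\operatorname{diam}(\overline{G})=3$ and $\kappa(G)=1$, where $\overline{G}$ is the complement of $G$. Then $G$ is reconstructible; that is, every graph $H$ with $\mathcal{D}(H)=\mathcal{D}(G)$ is isomorphic to $G$.
   Context: All graphs are finite and simple. $\operatorname{diam}(G)=\max_{u,v\in V(G)} d_G(u,v)$, where $d_G(u,v)$ is the length of a shortest path from $u$ to $v$ in $G$ (so a graph of finite diameter is connected). For a connected graph $G$, a set $S\subseteq V(G)$ is a cut set if $G-S$ is disconnected; the connectivity $\kappa(G)$ is the size of a smallest cut set. A card of $G$ is a graph $G-v$ with $v\in V(G)$, and the deck of $G$ is the multiset $\mathcal{D}(G)=\{G-v: v\in V(G)\}$, with cards considered up to isomorphism. Thus $\mathcal{D}(H)=\mathcal{D}(G)$ means there is a bijection $\varphi:V(G)\to V(H)$ with $G-v\cong H-\varphi(v)$ for all $v\in V(G)$. *)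

(* Defs.v *)
From mathcomp Require Import all_boot.
Set Implicit Arguments.
Unset Strict Implicit.
Unset Printing Implicit Defensive.

Record sgraph := SGraph {
  vertex :> finType;
  adj : rel vertex;
  adj_sym : symmetric adj;
  adj_irrefl : irreflexive adj }.

Definition edges (G : sgraph) : {set {set G}} :=
  [set [set p.1; p.2] | p : G * G & adj p.1 p.2].

Definition triangle_free (G : sgraph) : Prop :=
  forall x y z : G, ~~ [&& adj x y, adj y z & adj x z].

Definition isomorphic (G H : sgraph) : Prop :=
  exists2 f : G -> H, bijective f & forall x y, adj (f x) (f y) = adj x y.

Section Compl.
Variable G : sgraph.
Definition compl_adj : rel G := fun x y => (x != y) && ~~ adj x y.
Lemma compl_adj_sym : symmetric compl_adj.
Proof. by move=> x y; rewrite /compl_adj eq_sym adj_sym. Qed.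
Lemma compl_adj_irrefl : irreflexive compl_adj.
Proof. by move=> x; rewrite /compl_adj eqxx. Qed.
Definition compl : sgraph := SGraph compl_adj_sym compl_adj_irrefl.
End Compl.

Section Induced.
Variables (G : sgraph) (S : {set G}).
Definition induced_adj : rel {x : G | x \in S} := fun x y => adj (val x) (val y).
Lemma induced_adj_sym : symmetric induced_adj.
Proof. by move=> x y; rewrite /induced_adj adj_sym. Qed.
Lemma induced_adj_irrefl : irreflexive induced_adj.
Proof. by move=> x; rewrite /induced_adj adj_irrefl. Qed.
Definition induced : sgraph := SGraph induced_adj_sym induced_adj_irrefl.
End Induced.

Definition connected (G : sgraph) : bool :=
  [forall u : G, forall v : G, connect (@adj G) u v].

(* [p] lists the vertices after [u], so its size is the length of the path. *)
Definition has_path (G : sgraph) (u v : G) (n : nat) : bool :=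
  [exists p : n.-tuple G,
    [&& path (@adj G) u p, uniq (u :: p) & last u p == v]].

(* A path has fewer than #|G| edges, so the value #|G| is taken exactly when
   no path joins [u] to [v]. *)
Definition dist (G : sgraph) (u v : G) : nat :=
  \big[minn/#|G|]_(n < #|G| | has_path u v n) n.

(* [None] is infinite diameter. *)
Definition diam (G : sgraph) : option nat :=
  if connected G then Some (\max_(u : G) \max_(v : G) dist u v) else None.

Definition cut_set (G : sgraph) (S : {set G}) : bool :=
  ~~ connected (induced (~: S)).

(* A cut set leaves at least two vertices, so it has fewer than #|G|.-1
   elements: the value #|G|.-1 is taken exactly when there is no cut set, i.e.
   when [G] is complete. *)
Definition connectivity (G : sgraph) : nat :=
  \big[minn/#|G|.-1]_(S : {set G} | cut_set S) #|S|.

Definition deck_card (G : sgraph) (v : G) : sgraph := induced [set~ v].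

Definition same_deck (G H : sgraph) : Prop :=
  exists2 phi : G -> H, bijective phi &
    forall v : G, isomorphic (deck_card v) (deck_card (phi v)).

Definition reconstructible (G : sgraph) : Prop :=
  forall H : sgraph, same_deck G H -> isomorphic H G.

(* Main.v *)
Require Import Defs.
From mathcomp Require Import all_boot order.
From mathcomp Require Import zify.

(** Distance 3 between [u] and [v] in the complement says that [u] and [v] are
    adjacent and every other vertex is adjacent to one of them; as [G] has no
    triangle, the neighbourhood of [v] is exactly the complement of that of [u].
    So [G] is bipartite with parts [nbh u] and [nbh v], each of the two centers
    being joined to the whole opposite part ([compl_diam3_nbhs]).

    Let [H] have the same deck, with [phi] matching the cards. Counting edges
    shows that [phi] preserves degrees ([deg_phi]), and counting squares of
    degrees shows that it preserves the sum of the degrees of the neighbours of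
    each vertex ([nbr_deg_sum_phi]). In a triangle-free graph this sum equals
    the number of edges exactly when every edge has one end in the
    neighbourhood ([splitsE]). Hence the neighbourhood of [phi u] is one part of
    a bipartition of [H], and so is that of [phi v] ([splits_phi]).

    Now take an isomorphism from the card [G - u] to [H - phi u]. Apart from
    the pendant vertices at [u], which are isolated in [G - u], this card is
    connected through [v], so the part adjacent to [phi u] pulls back either to
    the part of [v], and the isomorphism extends to [G], or to the other part
    together with the pendant vertices. Comparing sizes, the second case forces
    [#|pendants u| + deg v = (deg u).+1] ([center_card]). If both centers are in
    the second case, adding the two equations gives two pendant vertices in all.

    If both hang on the same center, deleting one leaves the other to mark that
    center, so the card of a pendant vertex determines where to reattach it
    ([concentrated_pendants_iso]). If each center carries one, the centers have
    equal degrees; deleting a pendant vertex makes the parts of unequal size,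
    so its neighbour is known to lie in the larger part, and its degree shows
    that it is joined to the whole smaller part, hence is a twin of [u] in the
    card ([balanced_pendant_iso]). *)

Set Implicit Arguments.
Unset Strict Implicit.
Unset Printing Implicit Defensive.

(** * Degrees and bipartitions *)

Lemma sum_reindex_bij (I J : finType) (F : I -> J) (P : pred J) (f : J -> nat) :
  bijective F -> \sum_(j | P j) f j = \sum_(i | P (F i)) f (F i).
Proof. by move=> Fb; apply: reindex; exact: onW_bij. Qed.

Section Basics.
Variable G : sgraph.
Implicit Types (x y : G) (S : {set G}).

Definition nbh x : {set G} := [set y | adj x y].
Definition deg x := #|nbh x|.
Definition pendants x : {set G} := [set y in nbh x | deg y == 1].
Definition nbr_deg_sum x := \sum_(y in nbh x) deg y.
Definition deg_sum := \sum_x deg x.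
Definition independent S := forall x y, x \in S -> y \in S -> ~~ adj x y.
Definition splits S := forall x y, adj x y -> (y \in S) = (x \notin S).

Lemma in_nbh x y : (y \in nbh x) = adj x y.
Proof. by rewrite inE. Qed.

Lemma degE x : deg x = \sum_y adj x y.
Proof.
rewrite /deg -sum1_card big_mkcond.
by apply: eq_bigr => y _; rewrite inE; case: adj.
Qed.

Lemma deg1_nbr x y z : deg x = 1 -> adj x y -> adj x z -> y = z.
Proof.
by move=> /eqP/cards1P[t nt]; rewrite -!in_nbh nt !inE => /eqP-> /eqP->.
Qed.

Lemma deg_gt0 x y : adj x y -> 0 < deg x.
Proof. by move=> xy; apply/card_gt0P; exists y; rewrite inE. Qed.

Lemma deg1I x y : adj x y -> (forall z, adj x z -> z = y) -> deg x = 1.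
Proof.
move=> xy h; apply/eqP/cards1P; exists y; apply/setP=> z; rewrite !inE.
by apply/idP/eqP => [/h|->].
Qed.

Lemma deg_off x : \sum_(y | y != x) (adj x y : nat) = deg x.
Proof. by rewrite degE [RHS](bigD1 x) //= adj_irrefl. Qed.

Lemma nbr_deg_sumE x : nbr_deg_sum x = \sum_(y | y != x) adj x y * deg y.
Proof.
rewrite /nbr_deg_sum big_mkcond (bigD1 x) //= inE adj_irrefl.
by apply: eq_bigr => y _; rewrite inE; case: adj; lia.
Qed.

(** Deleting [x] lowers exactly the degrees of its neighbours, each by one;
    expanding the squares leaves the neighbour degree sum as the only quantity
    that is not read off the degrees of the card and of the graph. *)
Lemma nbr_deg_sum_sqr x :
  2 * nbr_deg_sum x + \sum_(y | y != x) (deg y - adj x y) ^ 2 =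
  \sum_(y | y != x) deg y ^ 2 + deg x.
Proof.
rewrite -deg_off nbr_deg_sumE big_distrr -!big_split /=.
apply: eq_bigr => y _; case: (boolP (adj x y)) => [|_]; last by lia.
rewrite adj_sym => /deg_gt0; nia.
Qed.

(** A pendant vertex at [v] is an isolated vertex of the card at [v], hence
    visible in that card. *)
Lemma pendantsE v x : (forall y : G, 0 < deg y) ->
  (x \in pendants v) = (x != v) && [forall y, (y != v) ==> ~~ adj x y].
Proof.
move=> deg_pos; rewrite !inE; apply/andP/andP => [[vx /eqP d1]|[xv /forallP h]].
  split; first by apply: contraTneq vx => ->; rewrite adj_irrefl.
  apply/forallP => y; apply/implyP; apply: contraNN => xy; apply/eqP.
  by apply: (deg1_nbr d1) => //; rewrite adj_sym.
have h' y : adj x y -> y = v.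
  by move=> xy; apply/eqP; have := h y; rewrite xy; case: eqP.
have /card_gt0P[y] := deg_pos x; rewrite inE => xy.
move: (xy); rewrite (h' _ xy) => xv'; split; first by rewrite adj_sym.
by apply/eqP/(deg1I xv').
Qed.

Lemma splitsC S : splits S -> splits (~: S).
Proof. by move=> h x y /h; rewrite !inE => ->. Qed.

(** Each edge with an end in the independent set [S] is counted once in the sum
    of the degrees over [S], so twice this sum falls short of the total degree
    by twice the number of edges that avoid [S]. Bipartitions are thereby
    detected by degrees alone. *)
Lemma splitsE S : independent S ->
  splits S <-> 2 * \sum_(x in S) deg x = deg_sum.
Proof.
move=> iS.
have sdeg x : deg x = \sum_(y in S) adj x y + \sum_(y in ~: S) adj x y.
  rewrite degE (bigID (mem S)) /=; congr (_ + _).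
  by apply: eq_bigl => y; rewrite inE.
have inS : \sum_(x in S) deg x = \sum_(x in ~: S) \sum_(y in S) adj x y.
  rewrite [RHS]exchange_big /=; apply: eq_bigr => x xS.
  rewrite sdeg big1 => [|y yS]; last by rewrite (negbTE (iS _ _ xS yS)).
  by apply: eq_bigr => y _; rewrite adj_sym.
have tot : deg_sum = \sum_(x in S) deg x + \sum_(x in ~: S) deg x.
  rewrite /deg_sum (bigID (mem S)) /=; congr (_ + _).
  by apply: eq_bigl => y; rewrite inE.
have outS : \sum_(x in ~: S) deg x =
    \sum_(x in S) deg x + \sum_(x in ~: S) \sum_(y in ~: S) adj x y.
  by rewrite inS -big_split; apply: eq_bigr => x _; exact: sdeg.
have -> : (2 * \sum_(x in S) deg x = deg_sum) <->
    (\sum_(x in ~: S) \sum_(y in ~: S) adj x y = 0).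
  by rewrite tot outS; split; lia.
split=> [h|/eqP].
  rewrite big1 // => x xS; rewrite big1 // => y yS.
  by case: (boolP (adj x y)) => // /h; move: xS yS; rewrite !inE => -> /negbTE->.
rewrite sum_nat_eq0 => /forall_inP h x y xy.
case: (boolP (x \in S)) => xS /=.
  by apply: contraTF xy => yS; apply: iS.
have := h x; rewrite inE xS => /(_ isT); rewrite sum_nat_eq0 => /forall_inP/(_ y).
by rewrite inE xy; case: (y \in S) => // /(_ isT).
Qed.

End Basics.

Lemma nbh_independent (G : sgraph) (u : G) :
  triangle_free G -> independent (nbh u).
Proof.
move=> tf x y; rewrite !inE => ux uy; apply/negP => xy.
by have := tf u x y; rewrite ux uy xy.
Qed.

Lemma isomorphic_sym (G H : sgraph) : isomorphic G H -> isomorphic H G.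
Proof.
by case=> f [g fg gf] fh; exists g; [exists f | move=> x y; rewrite -fh !gf].
Qed.

(** * Cards as maps between the whole graphs *)

(** An isomorphism between two cards, extended by sending the deleted vertex to
    the deleted vertex: all cards are then compared through functions on the
    same two types. *)
Definition extends_card_iso (G H : sgraph) (v : G) (w : H) (F : G -> H) :=
  [/\ bijective F, F v = w &
      forall x y, x != v -> y != v -> adj (F x) (F y) = adj x y].

Lemma extend_card_iso (G H : sgraph) (v : G) (w : H) : #|G| = #|H| ->
  isomorphic (deck_card v) (deck_card w) -> exists F, extends_card_iso v w F.
Proof.
move=> cGH [f fbij fadj].
pose F (x : G) : H := oapp (fun s => val (f s)) w (insub x).
have Fv : F v = w by rewrite /F insubF //= !inE eqxx.
have Fn x (xv : x != v) : exists2 s : deck_card v, val s = x & F x = val (f s).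
  have xin : x \in [set~ v] by rewrite !inE.
  by exists (Sub x xin) => //; rewrite /F insubT.
have Fw (s : deck_card v) : val (f s) != w by have := valP (f s); rewrite !inE.
exists F; split=> // [|x y /Fn[s <- ->] /Fn[t <- ->]]; last exact: fadj.
apply: inj_card_bij; last by rewrite cGH.
move=> x y; have [->|/Fn[s <- ->]] := eqVneq x v.
  have [->//|/Fn[t <- ->]] := eqVneq y v.
  by rewrite Fv => e; case/eqP: (Fw t).
have [->|/Fn[t <- ->]] := eqVneq y v.
  by rewrite Fv => /eqP; rewrite (negbTE (Fw s)).
by move=> /val_inj/(bij_inj fbij)->.
Qed.

Lemma extended_iso (G H : sgraph) (v : G) (w : H) (F : G -> H) :
  extends_card_iso v w F ->
  (forall x, x != v -> adj w (F x) = adj v x) -> isomorphic G H.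
Proof.
move=> [Fb Fv Fadj] h; exists F => // x y.
have [->|xv] := eqVneq x v; have [->|yv] := eqVneq y v.
- by rewrite !adj_irrefl.
- by rewrite Fv h.
- by rewrite Fv adj_sym h // adj_sym.
- exact: Fadj.
Qed.

(** * Two centers with complementary neighbourhoods *)

Section ComplementaryNbhs.
Variable G : sgraph.
Implicit Types u v x : G.

Definition complementary_nbhs u v := forall x, adj v x = ~~ adj u x.

Lemma compl_nbhsC u v : complementary_nbhs u v -> complementary_nbhs v u.
Proof. by move=> h x; rewrite h negbK. Qed.

Lemma compl_nbhs_adj u v : complementary_nbhs u v -> adj u v.
Proof. by move=> h; rewrite -[adj u v]negbK -h adj_irrefl. Qed.

Lemma compl_nbhs_splits u v :
  triangle_free G -> complementary_nbhs u v -> splits (nbh u).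
Proof.
move=> tf h x y xy; rewrite !in_nbh; have := tf u x y; have := tf v x y.
by rewrite !h xy; do 2!case: adj.
Qed.

Lemma compl_nbhs_deg u v : complementary_nbhs u v -> deg u + deg v = #|G|.
Proof.
move=> h; rewrite -[RHS](cardsC (nbh u)); congr (_ + _).
by apply: eq_card => x; rewrite !inE h.
Qed.

Lemma compl_nbhs_deg_gt0 u v : complementary_nbhs u v -> forall x, 0 < deg x.
Proof.
move=> h x; case: (boolP (adj u x)); last rewrite -h.
all: by rewrite adj_sym; exact: deg_gt0.
Qed.

End ComplementaryNbhs.

(** * What the deck determines *)

Section Deck.
Variables (G H : sgraph) (phi : G -> H).
Hypothesis phi_bij : bijective phi.
Hypothesis phi_card : forall v, exists F, extends_card_iso v (phi v) F.
Hypothesis G3 : 3 <= #|G|.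

Lemma deg_extends v F x : extends_card_iso v (phi v) F -> x != v ->
  deg (F x) + adj v x = deg x + adj (phi v) (F x).
Proof.
move=> [Fb Fv Fadj] xv; rewrite !degE.
rewrite (sum_reindex_bij _ _ Fb) /=.
rewrite (bigD1 v) // [X in _ = X + _](bigD1 v) //= Fv.
rewrite (eq_bigr (fun y => adj x y : nat)) => [|y yv]; last by rewrite Fadj.
rewrite [adj (F x) _]adj_sym [adj x v]adj_sym; lia.
Qed.

Lemma deg_sum_deg_phi v : deg_sum H + 2 * deg v = deg_sum G + 2 * deg (phi v).
Proof.
have [F HF] := phi_card v; have [Fb Fv _] := HF.
have ni x : (F x != phi v) = (x != v) by rewrite -Fv (inj_eq (bij_inj Fb)).
have e1 : \sum_(y | y != phi v) deg y + deg v =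
    \sum_(x | x != v) deg x + deg (phi v).
  rewrite -deg_off -[deg (phi v)]deg_off.
  rewrite !(sum_reindex_bij _ _ Fb) /= !(eq_bigl _ _ ni) -!big_split /=.
  by apply: eq_bigr => x; apply: deg_extends.
rewrite /deg_sum (bigD1 (phi v)) //= [\sum_x deg x](bigD1 v) //=; lia.
Qed.

(** Summing the relation between the cards over all vertices gives
    [(n - 2) * deg_sum H = (n - 2) * deg_sum G] for [n] vertices. *)
Lemma deg_phi v : deg (phi v) = deg v.
Proof.
suff e : deg_sum H = deg_sum G by have := deg_sum_deg_phi v; lia.
have : \sum_(v : G) (deg_sum H + 2 * deg v) =
    \sum_(v : G) (deg_sum G + 2 * deg (phi v)).
  by apply: eq_bigr => x _; exact: deg_sum_deg_phi.
rewrite !big_split /= !sum_nat_const.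
rewrite -(sum_reindex_bij xpredT (@deg H) phi_bij).
rewrite -/(deg_sum _) -/(deg_sum _); set n := #|_|; have n3 : 2 < n := G3.
by case: (ltngtP (deg_sum H) (deg_sum G)) => //; nia.
Qed.

Lemma deg_sum_phi : deg_sum H = deg_sum G.
Proof.
rewrite /deg_sum (sum_reindex_bij _ _ phi_bij) /=.
by apply: eq_bigr => x _; exact: deg_phi.
Qed.

Lemma nbr_deg_sum_phi v : nbr_deg_sum (phi v) = nbr_deg_sum v.
Proof.
have [F HF] := phi_card v; have [Fb Fv _] := HF.
have ni x : (F x != phi v) = (x != v) by rewrite -Fv (inj_eq (bij_inj Fb)).
have np x : (phi x != phi v) = (x != v) by rewrite (inj_eq (bij_inj phi_bij)).
have := nbr_deg_sum_sqr (phi v); have := nbr_deg_sum_sqr v.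
rewrite deg_phi [X in _ + X = _ -> _](_ : _ =
    \sum_(y | y != phi v) (deg y - adj (phi v) y) ^ 2).
  rewrite [X in _ = X + _ -> _](_ : _ = \sum_(y | y != phi v) deg y ^ 2).
    lia.
  rewrite [RHS](sum_reindex_bij _ _ phi_bij) /= (eq_bigl _ _ np).
  by apply: eq_bigr => x _; rewrite deg_phi.
rewrite [RHS](sum_reindex_bij _ _ Fb) /= (eq_bigl _ _ ni).
apply: eq_bigr => x xv; congr (_ ^ 2); have := deg_extends HF xv.
have sub (K : sgraph) (a b : K) : adj a b <= deg b.
  by case: (boolP (adj a b)) => //; rewrite adj_sym => /deg_gt0.
have := sub _ v x; have := sub _ (phi v) (F x); lia.
Qed.

(** For an independent neighbourhood, splitting the graph is a condition on the
    neighbour degree sum and the total degree, and the deck determines both. *)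
Lemma splits_phi v : triangle_free G -> triangle_free H ->
  splits (nbh v) -> splits (nbh (phi v)).
Proof.
move=> tfG tfH /(splitsE (nbh_independent tfG)) e.
apply/(splitsE (nbh_independent tfH)); rewrite deg_sum_phi -e.
by rewrite -[in RHS]/(nbr_deg_sum v) -nbr_deg_sum_phi.
Qed.

(** A triangle misses some vertex, so it appears in a card. *)
Lemma triangle_free_phi : 4 <= #|G| -> triangle_free G -> triangle_free H.
Proof.
move=> G4 tf a b c; apply/negP => /and3P[ab bc ac].
have [psi psiK phiK] := phi_bij.
have cH : #|H| = #|G| by rewrite (bij_eq_card phi_bij).
have [z zS] : exists z, z \notin [:: a; b; c].
  apply/existsP; apply: contraTT isT; rewrite negb_exists => /forallP h.
  have : #|H| <= size [:: a; b; c].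
    apply: leq_trans (card_size _); apply/subset_leq_card/subsetP => y _.
    by have := h y; rewrite negbK.
  by rewrite cH leqNgt G4.
have [F [[F' F1 F2] Fv Fadj]] := phi_card (psi z).
have nv y : y \in [:: a; b; c] -> F' y != psi z.
  move=> yS; apply: contraNneq zS => e.
  by move: yS; rewrite -[y]F2 e Fv phiK.
have := tf (F' a) (F' b) (F' c).
by rewrite -!Fadj ?F2 ?ab ?bc ?ac // nv // !inE eqxx ?orbT.
Qed.

Hypothesis deg_gt0_G : forall x : G, 0 < deg x.

Lemma deg_gt0_H y : 0 < deg (y : H).
Proof. by have [psi _ phiK] := phi_bij; rewrite -[y]phiK deg_phi. Qed.

Lemma pendants_card v F x : extends_card_iso v (phi v) F ->
  (F x \in pendants (phi v)) = (x \in pendants v).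
Proof.
move=> [Fb Fv Fadj]; rewrite !pendantsE //; last exact: deg_gt0_H.
have ni y : (F y != phi v) = (y != v) by rewrite -Fv (inj_eq (bij_inj Fb)).
rewrite ni; case: (boolP (x != v)) => //= xv.
have [F' F1 F2] := Fb; apply/forallP/forallP => h y.
  by apply/implyP => yv; have := h (F y); rewrite ni yv Fadj.
by apply/implyP; rewrite -[y]F2 ni => yv; rewrite Fadj //; apply: (implyP (h _)).
Qed.

Lemma card_pendants_phi v : #|pendants (phi v)| = #|pendants v|.
Proof.
have [F HF] := phi_card v; have [Fb _ _] := HF.
rewrite -(card_imset (mem (pendants v)) (bij_inj Fb)); apply: eq_card => y.
have [F' _ F2] := Fb; rewrite -[y]F2 (pendants_card _ HF).
by rewrite mem_imset //; exact: bij_inj Fb.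
Qed.

(** * Extending an isomorphism between two cards *)

(** The neighbourhood of [phi u], pulled back to the card [G - u], contains all
    pendant vertices at [u], since these must not be isolated in [H]. The rest
    of the card is connected through [v], so its bipartition is unique and the
    pullback is decided by the side of [v]: either it is [nbh u], or it is
    [pendants u] together with [nbh v :\ u], and its size is [deg u]. *)
Lemma center_card u v : triangle_free G -> complementary_nbhs u v ->
  splits (nbh (phi u)) -> isomorphic G H \/ #|pendants u| + deg v = (deg u).+1.
Proof.
move=> tf uv spl; have [F HF] := phi_card u; have [Fb Fu Fadj] := HF.
have vu : v != u.
  by apply: contraTneq (compl_nbhs_adj uv) => ->; rewrite adj_irrefl.
(* Off the pendant vertices at [u], membership in the pullback is constant on
   each part of the card. *)
have inB x : x != u -> adj v x -> (F x \in nbh (phi u)) = (F v \notin nbh (phi u)).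
  by move=> xu vx; apply: spl; rewrite Fadj.
have inP x : x \in pendants u -> F x \in nbh (phi u).
  by rewrite -(pendants_card _ HF) inE => /andP[].
have inA x : adj u x -> x \notin pendants u ->
    (F x \in nbh (phi u)) = (F v \in nbh (phi u)).
  move=> ux; have xu : x != u by apply: contraTneq ux => ->; rewrite adj_irrefl.
  rewrite pendantsE // xu negb_forall => /existsP[y]; rewrite negb_imply negbK.
  case/andP=> yu xy; have vy : adj v y.
    by rewrite uv; apply/negP => uy; have := tf u x y; rewrite ux xy uy.
  have /spl := etrans (Fadj x y xu yu) xy; rewrite inB //.
  by case: (F x \in _); case: (F v \in _).
case: (boolP (F v \in nbh (phi u))) => Fv; [left | right].
  apply: (extended_iso HF) => x xu; rewrite -in_nbh.
  case: (boolP (adj u x)) => [ux|]; last by rewrite -uv => /inB->//; rewrite Fv.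
  by case: (boolP (x \in pendants u)) => [/inP//|/inA->].
have -> : (deg u).+1 = #|pendants u :|: (nbh v :\ u)|.+1.
  rewrite -(deg_phi u) /deg -(on_card_preimset (onW_bij _ Fb)).
  congr _.+1; apply: eq_card => x; rewrite inE in_setU in_setD1 (in_nbh v).
  have [->|xu] := eqVneq x u; first by rewrite Fu !inE !adj_irrefl.
  case: (boolP (x \in pendants u)) => [/inP->//|xP] /=.
  case: (boolP (adj v x)) => [vx|]; first by rewrite inB.
  by rewrite uv negbK => /inA->//; exact: negbTE.
rewrite cardsU disjoint_setI0 ?cards0 ?subn0; last first.
  rewrite disjoint_subset; apply/subsetP => x; rewrite !inE => /andP[ux _].
  by rewrite uv ux andbF.
rewrite /deg (cardsD1 u (nbh v)) in_nbh adj_sym compl_nbhs_adj //; lia.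
Qed.

(** [H] has as many vertices of degree 1 as [G], and [phi u] has as many pendant
    vertices as [u]. *)
Lemma concentrated_pendants_phi u : (forall x : G, deg x = 1 -> adj u x) ->
  forall y : H, deg y = 1 -> adj (phi u) y.
Proof.
move=> hu; pose L (K : sgraph) := [set x : K | deg x == 1].
have eG : pendants u = L G.
  apply/setP => x; rewrite !inE; case: eqP => [/hu->//|_]; exact: andbF.
have eH : pendants (phi u) = L H.
  apply/eqP; rewrite eqEcard; apply/andP; split.
    by apply/subsetP => y; rewrite !inE => /andP[].
  rewrite card_pendants_phi // eG -(on_card_preimset (onW_bij _ phi_bij)).
  by apply/subset_leq_card/subsetP => x; rewrite !inE deg_phi.
move=> y /eqP y1; have : y \in L H by rewrite inE.
by rewrite -eH !inE => /andP[].
Qed.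

(** After deleting the pendant vertex [a], another pendant vertex [b] remains at
    [u]. Its image is pendant in [H] too, so it hangs on [phi u], and the image
    of [u] must be [phi u]: that is where [phi a] is attached. *)
Lemma concentrated_pendants_iso u : (forall x : G, deg x = 1 -> adj u x) ->
  1 < #|pendants u| -> 2 < deg u -> isomorphic G H.
Proof.
move=> hu /card_gt1P[a [b [aP bP ab]]] du.
have hH := concentrated_pendants_phi hu.
move: aP bP; rewrite !inE => /andP[ua /eqP da] /andP[ub /eqP db].
have [F HF] := phi_card a; have [Fb Fa Fadj] := HF.
have [F' _ F2] := Fb; have ba : b != a by rewrite eq_sym.
have nbrb x : x != a -> adj (F b) (F x) -> x = u.
  by move=> xa; rewrite Fadj // => bx; apply: (deg1_nbr db) => //; rewrite adj_sym.
have dpa : deg (phi a) = 1 by rewrite deg_phi.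
have nbra y : adj (phi a) y -> y = phi u.
  by move=> ay; apply: (deg1_nbr dpa ay); rewrite adj_sym hH.
have Fau : adj (phi a) (phi u) by rewrite adj_sym hH.
have [x Fx] : exists x, F x = phi u by exists (F' (phi u)); exact: F2.
have xa : x != a.
  by apply: contraTneq Fau => e; rewrite -Fx e Fa adj_irrefl.
have ux : u != a by apply: contraTneq ua => ->; rewrite adj_irrefl.
suff Fu : F u = phi u.
  apply: (extended_iso HF) => y ya; apply/idP/idP => [/nbra|ay].
    by rewrite -Fu => /(bij_inj Fb)->; rewrite adj_sym.
  have -> : y = u by apply: (deg1_nbr da ay); rewrite adj_sym.
  by rewrite Fu.
(* If [F b] were adjacent to [phi a], it would be its only neighbour [phi u]; but
   [F b] has no neighbour besides [phi a] and [F u]. *)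
have [Fba|Fba] := boolP (adj (phi a) (F b)).
  have e := nbra _ Fba.
  suff : deg (phi u) <= #|[set phi a; F u]|.
    by rewrite deg_phi cards2 leqNgt (leq_ltn_trans _ du) //; case: (_ != _).
  apply/subset_leq_card/subsetP => y; rewrite !inE -e -{1}[y]F2 => bu.
  have [ya|ya] := eqVneq (F' y) a; first by rewrite -[y]F2 ya Fa eqxx.
  by rewrite -(nbrb _ ya bu) F2 eqxx orbT.
have dFb : deg (F b) = 1.
  have := deg_extends HF ba; rewrite (negbTE Fba) db.
  by have := deg_gt0_H (F b); case: (deg (F b)) => [|[|n]].
have xu : x = u by apply: nbrb => //; rewrite Fx adj_sym hH.
by rewrite -{1}xu.
Qed.

(** If the deleted pendant vertex is reattached to a twin of [u] in the card,
    exchanging the twins puts it back at [u]. *)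
Lemma twin_iso a (F : G -> H) u z : extends_card_iso a (phi a) F ->
  nbh a = [set u] -> nbh (phi a) = [set F z] -> z != a ->
  (forall x, x != a -> adj z x = adj u x) -> isomorphic G H.
Proof.
move=> [Fb Fa Fadj] na npa za tw.
have ua : u != a.
  by apply/eqP => e; have := in_nbh a a; rewrite na e set11 adj_irrefl.
have uz : ~~ adj u z by rewrite -tw // adj_irrefl.
pose t x := if x == u then z else if x == z then u else x.
have tK : involutive t.
  move=> x; rewrite /t; have [->|xu] := eqVneq x u.
    by rewrite eqxx; case: eqP.
  by have [->|xz] := eqVneq x z; rewrite ?eqxx // (negbTE xu) (negbTE xz).
have ta x : x != a -> t x != a by move=> xa; rewrite /t; do 2?case: ifP.
have tl x y : x != a -> y != a -> adj (t x) y = adj x y.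
  move=> xa ya; rewrite /t; case: eqVneq => [->|_]; first exact: tw.
  by case: eqVneq => [->|//]; rewrite tw.
apply: (@extended_iso _ _ a (phi a) (F \o t)); last first.
  move=> x xa; rewrite -!in_nbh na npa !inE /= (inj_eq (bij_inj Fb)) /t.
  case: (eqVneq x u) => [_|xu]; first by rewrite eqxx.
  by apply/negbTE; case: (eqVneq x z) => [<-|//]; rewrite eq_sym.
split; first by apply: bij_comp => //; exists t.
  by rewrite /= /t !ifN // eq_sym.
by move=> x y xa ya /=; rewrite Fadj ?ta // tl ?ta // adj_sym tl // adj_sym.
Qed.

(** [H] has two parts of equal size. The part [S] that contains [phi a] loses a
    vertex in the card, while in [G - a] the part [nbh u] of [v] is the one that
    is smaller by one, so the card isomorphism carries [nbh u :\ a] onto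
    [S :\ phi a]. The neighbour [w] of [phi a] has degree [deg u = #|S|]: it is
    adjacent to all of [S], and its preimage is a twin of [u]. *)
Lemma balanced_pendant_iso u v a : complementary_nbhs u v -> 1 < deg v ->
  deg u = deg v -> splits (nbh (phi u)) -> a \in pendants u -> isomorphic G H.
Proof.
move=> uv dv duv spl; rewrite !inE => /andP[ua /eqP da].
have [F HF] := phi_card a; have [Fb Fa Fadj] := HF; have [F' F1 F2] := Fb.
have na : nbh a = [set u].
  apply/setP => x; rewrite !inE; apply/idP/eqP => [ax|->]; last by rewrite adj_sym.
  by apply: (deg1_nbr da ax); rewrite adj_sym.
have [w nw] : exists w, nbh (phi a) = [set w].
  by apply/cards1P; rewrite -/(deg _) deg_phi da.
(* At a pendant vertex the neighbour degree sum is the degree of one vertex. *)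
have dw : deg w = deg u.
  have := nbr_deg_sum_phi a; rewrite /nbr_deg_sum na nw !big_set1.
  exact.
have dpu := deg_phi u.
have cH : #|H| = #|G| by rewrite (bij_eq_card phi_bij).
have [S [aS Sspl cS]] :
    exists S : {set H}, [/\ phi a \in S, splits S & #|S| = deg u].
  have [aS|aS] := boolP (phi a \in nbh (phi u)); first by exists (nbh (phi u)).
  exists (~: nbh (phi u)); split; [by rewrite inE| exact: splitsC|].
  have := cardsC (nbh (phi u)); rewrite -/(deg _) dpu cH -(compl_nbhs_deg uv); lia.
have aw : adj (phi a) w by rewrite -in_nbh nw set11.
have wS : w \notin S by rewrite (Sspl _ _ aw) aS.
have nwS : nbh w = S.
  apply/eqP; rewrite eqEcard cS -dw leqnn andbT.
  by apply/subsetP => y; rewrite inE => /Sspl->.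
have ua' : u != a by apply: contraTneq ua => ->; rewrite adj_irrefl.
have va : v != a by apply: contraTneq dv => ->; rewrite da.
have va' : ~~ adj v a by rewrite uv ua.
have uv' := compl_nbhs_adj uv.
have Fspl x y : x != a -> y != a -> adj x y -> (F y \in S) = (F x \notin S).
  by move=> xa ya xy; apply: Sspl; rewrite Fadj.
have cS' : #|F @^-1: S| = deg u by rewrite (on_card_preimset (onW_bij _ Fb)).
(* The other part of [G - a] is too large to be mapped into [S]. *)
have uS : F u \notin S.
  apply/negP => uS; suff : #|a |: nbh v| <= #|F @^-1: S|.
    by rewrite cardsU1 in_nbh va' cS' duv -/(deg v) add1n ltnn.
  apply/subset_leq_card/subsetP => x; rewrite !inE.
  case/orP => [/eqP->|vx]; first by rewrite Fa.
  have xa : x != a by apply: contraNneq va' => <-.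
  by rewrite (Fspl v) // (Fspl u) // uS.
have nuS : nbh u = F @^-1: S.
  apply/eqP; rewrite eqEcard cS' leqnn andbT.
  apply/subsetP => x; rewrite !inE => ux.
  have [->|xa] := eqVneq x a; first by rewrite Fa.
  by rewrite (Fspl u).
have za : F' w != a by apply: contraTneq aw => e; rewrite -[w]F2 e Fa adj_irrefl.
apply: (twin_iso HF na _ za); first by rewrite nw F2.
by move=> x xa; rewrite -Fadj // F2 -in_nbh nwS -in_nbh nuS inE.
Qed.

End Deck.

(** * Reconstruction *)

Lemma compl_nbhs_recon (G : sgraph) (u v : G) : 4 <= #|G| ->
  triangle_free G -> complementary_nbhs u v -> reconstructible G.
Proof.
move=> G4 tf uv H [phi phi_bij phi_deck]; apply: isomorphic_sym.
have phi_card x : exists F, extends_card_iso x (phi x) F.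
  by apply: extend_card_iso => //; exact: bij_eq_card phi_bij.
have G3 : 2 < #|G| by exact: ltnW.
have tfH := triangle_free_phi phi_bij phi_card G4 tf.
have deg_gt0_G := compl_nbhs_deg_gt0 uv.
have spl x y (xy : complementary_nbhs x y) : splits (nbh (phi x)) :=
  splits_phi phi_bij phi_card G3 tf tfH (compl_nbhs_splits tf xy).
have vu := compl_nbhsC uv.
have [//|pu] := center_card phi_bij phi_card G3 deg_gt0_G tf uv (spl _ _ uv).
have [//|pv] := center_card phi_bij phi_card G3 deg_gt0_G tf vu (spl _ _ vu).
have duv : 4 <= deg u + deg v by rewrite (compl_nbhs_deg uv).
(* [pu] and [pv] add up to two pendant vertices at [u] and [v] together. *)
have conc (x y : G) : complementary_nbhs x y -> #|pendants y| = 0 ->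
    forall z, deg z = 1 -> adj x z.
  move=> xy /eqP; rewrite cards_eq0 => /eqP py z dz.
  apply: contraT; rewrite -xy => yz.
  by have : z \in pendants y; [rewrite !inE yz dz | rewrite py inE].
have [e|[e|e]] :
    #|pendants u| = 0 \/ #|pendants u| = 1 \/ #|pendants v| = 0 by lia.
- have h := conc _ _ vu e.
  by apply: (concentrated_pendants_iso phi_bij phi_card G3 deg_gt0_G h); lia.
- have /card_gt0P[a aP] : 0 < #|pendants u| by rewrite e.
  apply: (balanced_pendant_iso phi_bij phi_card G3 uv _ _ (spl _ _ uv) aP); lia.
- have h := conc _ _ uv e.
  by apply: (concentrated_pendants_iso phi_bij phi_card G3 deg_gt0_G h); lia.
Qed.

(** * Distances in the complement *)

Lemma dist_leq (G : sgraph) (x y : G) (p : seq G) : size p < #|G| ->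
  path (@adj G) x p -> uniq (x :: p) -> last x p = y -> dist x y <= size p.
Proof.
move=> sz xp up lp; have hp : has_path x y (size p).
  by apply/existsP; exists (in_tuple p); rewrite /= in up *; rewrite xp up lp /=.
exact: (@Order.TotalTheory.bigmin_le_cond _ nat _ _ (Ordinal sz)
          _ (@nat_of_ord _)).
Qed.

(** The absence of walks of length 1 and 2 from [u] to [v] in the complement
    makes [u] and [v] adjacent with every other vertex next to one of them; a
    triangle-free graph has no vertex next to both. *)
Lemma compl_diam3_nbhs (G : sgraph) : 3 <= #|G| -> triangle_free G ->
  diam (compl G) = Some 3 -> exists u v : G, complementary_nbhs u v.
Proof.
move=> G3 tf; rewrite /diam; case: ifP => // _ [d3].
have G0 : 0 < #|compl G| by exact: ltnW (ltnW G3).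
have [u du] := eq_bigmax (fun u : compl G => \max_v dist u v) G0.
have [v dv] := eq_bigmax (fun v : compl G => dist u v) G0.
have far (p : seq (compl G)) : size p < 3 ->
    path (@adj (compl G)) u p -> uniq (u :: p) -> last u p != v.
  move=> sz up unp; apply/eqP => lp.
  have := dist_leq (leq_trans sz G3) up unp lp.
  by rewrite -dv -du d3 leqNgt sz.
have uv : u != v := far [::] isT isT isT.
have auv : @adj G u v.
  apply: contraT => nuv; have := far [:: v] isT.
  by rewrite /= /compl_adj inE uv nuv eqxx => /(_ isT isT).
exists u, v => x.
have := tf u v x; rewrite auv /=.
have [->|xu] := eqVneq x u; first by rewrite adj_irrefl adj_sym auv.
have [->|xv] := eqVneq x v; first by rewrite adj_irrefl auv.
case: (boolP (@adj G u x)) => ux; case: (boolP (@adj G v x)) => vx //.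
have ux' : u != x by rewrite eq_sym.
have := far [:: x; v] isT; rewrite /= /compl_adj !inE.
rewrite (negbTE ux') xv (negbTE uv) ux [adj x v]adj_sym vx eqxx.
by move=> /(_ isT isT).
Qed.

Lemma card_edges_leq (G : sgraph) : #|edges G| <= 'C(#|G|, 2).
Proof.
rewrite -(card_draws G 2); apply/subset_leq_card/subsetP => e /imsetP[[x y]].
rewrite !inE /= => xy ->; rewrite cards2.
suff -> : x != y by [].
by apply: contraTneq xy => ->; rewrite adj_irrefl.
Qed.

Theorem theorem1p9 (G : sgraph)
  (hG : triangle_free G)
  (hE : 4 <= #|edges G|)
  (hdiam : diam G = Some 3)
  (hdiamC : diam (compl G) = Some 3)
  (hkappa : connectivity G = 1) :
  reconstructible G.
Proof.
have G4 : 4 <= #|G|.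
  rewrite leqNgt; apply/negP => G3; have := leq_trans hE (card_edges_leq G).
  by rewrite leqNgt (leq_ltn_trans (leq_bin2l 2 (_ : #|G| <= 3))).
have [u [v uv]] := compl_diam3_nbhs (ltnW G4) hG hdiamC.
exact: compl_nbhs_recon uv.
Qed.
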